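(* Let $s, t \in T(2,1,1)$. Then $F(G(s)) = F(G(t))$ if and only if both of the following hold: (i) $s_{123} = t_{123}$ and $s_{134} = t_{134}$; and (ii) for each maximal prime power $p^k$ dividing $d(s)$ (that is, for each prime $p$ dividing $d(s)$, with $p^k$ the largest power of $p$ dividing $d(s)$) there exists $w_p \in \mathbb{Z}$ with $p \nmid w_p$ and $p^k \mid (t_{124} w_p - s_{124})$.
   Context: For a group $G$, $F(G)$ denotes the set of isomorphism classes of finite quotients of $G$. Let $\mathbb{Z}(4)$ be the set of all integer sequences $t = (t_{ijk} \in \mathbb{Z} \mid 1 \le i<j<k\le 4)$. For $t \in \mathbb{Z}(4)$ let $$G(t) = \langle g_1,\ldots,g_4 \mid [g_j,g_i] = g_{j+1}^{t_{i,j,j+1}} \cdots g_4^{t_{i,j,4}} \text{ for } 1 \le i<j\le 4\rangle$$ (empty products are trivial), where $[a,b] = a^{-1}b^{-1}ab$. Define $d(t) = \gcd(t_{123}, t_{134})$ and $$T(2,1,1) = \{ t \in \mathbb{Z}(4) \mid 0 < t_{123},\ 0 < t_{134};\ 0 \le t_{124} \le \tfrac{d(t)}{2};\ t_{234}=0\}.$$ (For $t\in T(2,1,1)$ the group $G(t)$ is a finitely generated torsion-free nilpotent group of Hirsch length $4$.) *)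

(* Defs.v *)
From HB Require Import structures.
From mathcomp Require Import all_boot all_order all_algebra.
From mathcomp Require Import boolp classical_sets cardinality.

Set Implicit Arguments.
Unset Strict Implicit.
Unset Printing Implicit Defensive.

Import Order.TTheory GRing.Theory Num.Theory.

Local Open Scope quotient_scope.
Local Open Scope group_scope.

(* Groups are the possibly infinite [groupType]s of monoid.v, where
   [~ a, b] = a^-1 * b^-1 * a * b and x ^ y = y^-1 * x * y. *)

Definition zexpg (G : groupType) (x : G) (z : int) : G :=
  match z with Posz n => x ^+ n | Negz n => x ^- n.+1 end.

Definition group_isog (G H : groupType) : Prop :=
  exists f : {multiplicative G -> H}, bijective f.

Record normalSubgroup (G : groupType) := NormalSubgroup {
  normal_set :> G -> Prop;
  normal1 : normal_set 1;
  normalM : forall x y, normal_set x -> normal_set y -> normal_set (x * y);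
  normalV : forall x, normal_set x -> normal_set x^-1;
  normalJ : forall x y, normal_set x -> normal_set (x ^ y) }.

Section QuotientGroup.
Variables (G : groupType) (N : normalSubgroup G).

Definition coset_rel (x y : G) : bool := `[< N (x^-1 * y) >].

Fact coset_rel_refl : reflexive coset_rel.
Proof. by move=> x; apply/asboolP; rewrite mulVg; exact: normal1. Qed.

Fact coset_rel_sym : symmetric coset_rel.
Proof.
have H x y : coset_rel x y -> coset_rel y x.
  by move=> /asboolP/normalV; rewrite invgM invgK => ?; apply/asboolP.
by move=> x y; apply/idP/idP; apply: H.
Qed.

Fact coset_rel_trans : transitive coset_rel.
Proof.
move=> y x z /asboolP Nxy /asboolP Nyz; apply/asboolP.
by have := normalM Nxy Nyz; rewrite -mulgA mulVKg.
Qed.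

Canonical coset_rel_equiv : equiv_rel G :=
  EquivRel coset_rel coset_rel_refl coset_rel_sym coset_rel_trans.

Definition quotientGroup := {eq_quot coset_rel}.
HB.instance Definition _ := Choice.on quotientGroup.
HB.instance Definition _ := EqQuotient.on quotientGroup.

Definition quotient_one : quotientGroup := \pi_quotientGroup 1.
Definition quotient_inv (a : quotientGroup) : quotientGroup :=
  \pi_quotientGroup (repr a)^-1.
Definition quotient_mul (a b : quotientGroup) : quotientGroup :=
  \pi_quotientGroup (repr a * repr b).

Fact coset_eqP (x y : G) :
  reflect (\pi_quotientGroup x = \pi_quotientGroup y) `[< N (x^-1 * y) >].
Proof. exact: eqmodP. Qed.

Fact coset_reprP (x : G) : N (x^-1 * repr (\pi_quotientGroup x)).
Proof. by apply/asboolP/coset_eqP; rewrite reprK. Qed.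

Fact quotient_mulE (x y : G) :
  quotient_mul (\pi x) (\pi y) = \pi_quotientGroup (x * y).
Proof.
rewrite /quotient_mul.
set x' := repr _; set y' := repr _.
have Nx : N (x^-1 * x') by exact: coset_reprP.
have Ny : N (y^-1 * y') by exact: coset_reprP.
apply/esym/coset_eqP/asboolP.
have := normalM (normalJ y Nx) Ny.
by rewrite conjgE invgM !mulgA mulgK.
Qed.

Fact quotient_invE (x : G) : quotient_inv (\pi x) = \pi_quotientGroup x^-1.
Proof.
rewrite /quotient_inv; set x' := repr _.
have Nx : N (x^-1 * x') by exact: coset_reprP.
apply/coset_eqP/asboolP.
have := normalJ (x^-1) Nx.
by rewrite conjgE !invgK !mulgA mulgV mul1g.
Qed.

Fact quotient_mulA : associative quotient_mul.
Proof.
by elim/quotW=> x; elim/quotW=> y; elim/quotW=> z; rewrite !quotient_mulE mulgA.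
Qed.

Fact quotient_mul1 : left_id quotient_one quotient_mul.
Proof. by elim/quotW=> x; rewrite quotient_mulE mul1g. Qed.

Fact quotient_mulr1 : right_id quotient_one quotient_mul.
Proof. by elim/quotW=> x; rewrite quotient_mulE mulg1. Qed.

Fact quotient_mulV : left_inverse quotient_one quotient_inv quotient_mul.
Proof. by elim/quotW=> x; rewrite quotient_invE quotient_mulE mulVg. Qed.

Fact quotient_mulrV : right_inverse quotient_one quotient_inv quotient_mul.
Proof. by elim/quotW=> x; rewrite quotient_invE quotient_mulE mulgV. Qed.

HB.instance Definition _ := isGroup.Build quotientGroup
  quotient_mulA quotient_mul1 quotient_mulr1 quotient_mulV quotient_mulrV.

End QuotientGroup.

Section FreeGroup.
Variable I : choiceType.

(* The letter (i, true) stands for the generator i, (i, false) for its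
   inverse. *)
Inductive free_eq : seq (I * bool) -> seq (I * bool) -> Prop :=
| free_eq_cancel u v i b :
    free_eq (u ++ [:: (i, b), (i, ~~ b) & v]) (u ++ v)
| free_eq_refl u : free_eq u u
| free_eq_sym u v : free_eq u v -> free_eq v u
| free_eq_trans u v w : free_eq u v -> free_eq v w -> free_eq u w.

Definition free_rel (u v : seq (I * bool)) : bool := `[< free_eq u v >].

Fact free_rel_refl : reflexive free_rel.
Proof. by move=> u; apply/asboolP; exact: free_eq_refl. Qed.

Fact free_rel_sym : symmetric free_rel.
Proof.
by move=> u v; apply/idP/idP => /asboolP H; apply/asboolP; exact: free_eq_sym.
Qed.

Fact free_rel_trans : transitive free_rel.
Proof.
move=> v u w /asboolP uv /asboolP vw; apply/asboolP.
exact: free_eq_trans uv vw.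
Qed.

Canonical free_rel_equiv : equiv_rel (seq (I * bool)) :=
  EquivRel free_rel free_rel_refl free_rel_sym free_rel_trans.

Definition freeGroup := {eq_quot free_rel}.
HB.instance Definition _ := Choice.on freeGroup.
HB.instance Definition _ := EqQuotient.on freeGroup.

Definition word_inv (u : seq (I * bool)) : seq (I * bool) :=
  rev [seq (a.1, ~~ a.2) | a <- u].

Definition free_one : freeGroup := \pi_freeGroup [::].
Definition free_inv (a : freeGroup) : freeGroup :=
  \pi_freeGroup (word_inv (repr a)).
Definition free_mul (a b : freeGroup) : freeGroup :=
  \pi_freeGroup (repr a ++ repr b).

Definition free_gen (i : I) : freeGroup := \pi_freeGroup [:: (i, true)].

Fact free_eqP u v : reflect (\pi_freeGroup u = \pi_freeGroup v) `[< free_eq u v >].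
Proof. exact: eqmodP. Qed.

Fact free_reprP u : free_eq u (repr (\pi_freeGroup u)).
Proof. by apply/asboolP/free_eqP; rewrite reprK. Qed.

Fact free_eq_cat u u' v v' :
  free_eq u u' -> free_eq v v' -> free_eq (u ++ v) (u' ++ v').
Proof.
move=> uu' vv'; apply: (@free_eq_trans _ (u' ++ v)).
  elim: uu' => {u u'} [u w i b|u|u u' _|u u' u'' _ + _].
  - by rewrite -!catA; exact: free_eq_cancel.
  - exact: free_eq_refl.
  - exact: free_eq_sym.
  - exact: free_eq_trans.
elim: vv' => {v v'} [v w i b|v|v v' _|v v' v'' _ + _].
- by rewrite !catA; exact: free_eq_cancel.
- exact: free_eq_refl.
- exact: free_eq_sym.
- exact: free_eq_trans.
Qed.

Fact free_eq_inv u v : free_eq u v -> free_eq (word_inv u) (word_inv v).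
Proof.
elim=> {u v} [u w i b|u|u u' _|u u' u'' _ + _].
- rewrite /word_inv !map_cat !rev_cat /= !rev_cons -!cats1 -!catA /=.
  by rewrite negbK; exact: free_eq_cancel.
- exact: free_eq_refl.
- exact: free_eq_sym.
- exact: free_eq_trans.
Qed.

Fact free_eq_catV u : free_eq (u ++ word_inv u) [::].
Proof.
elim: u => [|[i b] u IH]; first exact: free_eq_refl.
rewrite /word_inv /= rev_cons -cats1 catA -/(word_inv u).
apply: (@free_eq_trans _ ([:: (i, b)] ++ ([::] ++ [:: (i, ~~ b)]))).
  apply: (@free_eq_cat [:: (i, b)]); first exact: free_eq_refl.
  by apply: free_eq_cat; first exact: IH; exact: free_eq_refl.
exact: (free_eq_cancel [::] [::]).
Qed.

Fact word_invK : involutive word_inv.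
Proof.
move=> u; rewrite /word_inv map_rev revK -map_comp -[RHS]map_id.
by apply: eq_map => -[i b] /=; rewrite negbK.
Qed.

Fact free_mulE u v : free_mul (\pi u) (\pi v) = \pi_freeGroup (u ++ v).
Proof.
apply/esym/free_eqP/asboolP/free_eq_cat; exact: free_reprP.
Qed.

Fact free_invE u : free_inv (\pi u) = \pi_freeGroup (word_inv u).
Proof. apply/esym/free_eqP/asboolP/free_eq_inv; exact: free_reprP. Qed.

Fact free_mulA : associative free_mul.
Proof.
by elim/quotW=> u; elim/quotW=> v; elim/quotW=> w; rewrite !free_mulE catA.
Qed.

Fact free_mul1 : left_id free_one free_mul.
Proof. by elim/quotW=> u; rewrite free_mulE. Qed.

Fact free_mulr1 : right_id free_one free_mul.
Proof. by elim/quotW=> u; rewrite free_mulE cats0. Qed.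

Fact free_mulrV : right_inverse free_one free_inv free_mul.
Proof.
elim/quotW=> u; rewrite free_invE free_mulE.
exact/free_eqP/asboolP/free_eq_catV.
Qed.

Fact free_mulV : left_inverse free_one free_inv free_mul.
Proof.
elim/quotW=> u; rewrite free_invE free_mulE.
by apply/free_eqP/asboolP; rewrite -{2}(word_invK u); exact: free_eq_catV.
Qed.

HB.instance Definition _ := isGroup.Build freeGroup
  free_mulA free_mul1 free_mulr1 free_mulV free_mulrV.

End FreeGroup.

Section NormalClosure.
Variables (G : groupType) (A : set G).

Definition normal_closure_set : set G :=
  [set x | forall N : normalSubgroup G, (forall a, A a -> N a) -> N x].

Fact normal_closure1 : normal_closure_set 1.
Proof. by move=> N _; exact: normal1. Qed.

Fact normal_closureM x y : normal_closure_set x -> normal_closure_set y ->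
  normal_closure_set (x * y).
Proof. by move=> cx cy N AN; apply: normalM; [exact: cx|exact: cy]. Qed.

Fact normal_closureV x : normal_closure_set x -> normal_closure_set x^-1.
Proof. by move=> cx N AN; apply: normalV; exact: cx. Qed.

Fact normal_closureJ x y : normal_closure_set x -> normal_closure_set (x ^ y).
Proof. by move=> cx N AN; apply: normalJ; exact: cx. Qed.

Definition normal_closure : normalSubgroup G :=
  NormalSubgroup normal_closure1 normal_closureM normal_closureV
    normal_closureJ.

End NormalClosure.

Definition presentedGroup (I : choiceType) (relators : set (freeGroup I))
    : groupType :=
  quotientGroup (normal_closure relators).

(* [set groupType] is a universe inconsistency, so families of groups and
   families of isomorphism classes are bare predicates. *)
Definition iso_class (G : groupType) : groupType -> Prop :=
  fun H => group_isog G H.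

Definition finite_quotient_classes (G : groupType) :
    (groupType -> Prop) -> Prop :=
  fun C => exists N : normalSubgroup G,
    finite_set [set: quotientGroup N]%classic /\
    C = iso_class (quotientGroup N).

Record Z4 := MkZ4 { c123 : int; c124 : int; c134 : int; c234 : int }.

Definition coef (t : Z4) (i j k : nat) : int :=
  match i, j, k with
  | 1, 2, 3 => c123 t
  | 1, 2, 4 => c124 t
  | 1, 3, 4 => c134 t
  | 2, 3, 4 => c234 t
  | _, _, _ => 0%R
  end.

(* Indices in 'I_4 start at 0: the element i of 'I_4 names g_(i+1). *)
Definition gen4 (i : 'I_4) : freeGroup 'I_4 := free_gen i.

Definition relators (t : Z4) : set (freeGroup 'I_4) :=
  [set r | exists i j : 'I_4, (i < j)%N /\
    r = [~ gen4 j, gen4 i] /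
        \prod_(k < 4 | (j < k)%N) zexpg (gen4 k) (coef t i.+1 j.+1 k.+1)]%classic.

Definition Ggroup (t : Z4) : groupType := presentedGroup (relators t).

Definition dgcd (t : Z4) : int := gcdz (c123 t) (c134 t).

Definition T211 (t : Z4) : Prop :=
  [/\ (0 < c123 t)%R, (0 < c134 t)%R,
      (0 <= c124 t)%R /\ ((c124 t)%:Q <= (dgcd t)%:Q / 2)%R
    & c234 t = 0%R].

Definition maximal_prime_power (p k : nat) (n : int) : Prop :=
  [/\ prime p, (0 < k)%N, ((p ^ k)%N%:Z %| n)%Z & ~~ ((p ^ k.+1)%N%:Z %| n)%Z].

(* Main.v *)
(* Write a = t123, b = t124, c = t134, so that g2^g1 = g2 g3^a g4^b and
   g3^g1 = g3 g4^c. Condition (ii) says gcd(b_s, d) = gcd(b_t, d) for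
   d = gcd(a, c).

   If it holds, b_t u = b_s mod d with u prime to the exponent of a given finite
   quotient of G(s); replacing g1, g2, g3, g4 there by g1^u, g2 g3^f, g3^u g4^e,
   g4^(u^2), for e and f given by Bezout, yields generators that satisfy the
   relations of G(t).

   Conversely, equality of the finite quotients turns every homomorphism from
   G(s) to a finite group into one from G(t) with the same range. Applied to
   - the Heisenberg group with commutator x3^a modulo n = a N^2, whose class 2
     forces the image of g4 to be N-torsion, this gives a_s <= a_t by counting;
   - the torsion of the abelianization, it gives a_s c_s <= a_t c_t by counting;
   - (Z/g)^4 with g = gcd(a, b, c), it gives g_s | g_t.
   By symmetry all three are equalities. *)
From HB Require Import structures.
Require Import Defs.
From mathcomp Require Import all_boot all_order all_algebra.
From mathcomp Require Import boolp classical_sets cardinality.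
From mathcomp Require Import ring zify.

Set Implicit Arguments.
Unset Strict Implicit.
Unset Printing Implicit Defensive.

Import Order.TTheory GRing.Theory Num.Theory.

Local Open Scope quotient_scope.
Local Open Scope group_scope.

(** * Quotients of infinite groups and presentations *)

Lemma group_isog_sym (G H : groupType) : group_isog G H -> group_isog H G.
Proof.
case=> f [g fK gK].
pose gm := isMultiplicative.Build H G g (can2_gmulfM fK gK).
pose g' : {multiplicative H -> G} := HB.pack g gm.
by exists g'; exists f.
Qed.

Lemma group_isog_trans (G H K : groupType) :
  group_isog G H -> group_isog H K -> group_isog G K.
Proof.
case=> f bf [g bg].
have hM : {morph g \o f : x y / x * y} by move=> x y /=; rewrite !gmulfM.
pose hm := isMultiplicative.Build G K (g \o f) hM.
pose h : {multiplicative G -> K} := HB.pack (g \o f) hm.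
by exists h; exact: bij_comp.
Qed.

Lemma group_isog_refl (G : groupType) : group_isog G G.
Proof.
pose hm := isMultiplicative.Build G G (@id G) (fun x y => erefl).
pose h : {multiplicative G -> G} := HB.pack (@id G) hm.
by exists h; exists id.
Qed.

Lemma iso_class_eq (G H : groupType) :
  iso_class G = iso_class H <-> group_isog G H.
Proof.
split=> [GH|GH].
  by rewrite -/(iso_class G H) GH; exact: group_isog_refl.
apply/funext => K; apply/propext; split; apply: group_isog_trans => //.
exact: group_isog_sym.
Qed.

Section Morphisms.
Variables (G H : groupType) (f : G -> H).
Hypothesis fM : {morph f : x y / x * y}.

Lemma morph_group1 : f 1 = 1.
Proof. by apply: (@mulgI _ (f 1)); rewrite -fM !mulg1. Qed.

Lemma morph_groupV : {morph f : x / x^-1}.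
Proof.
by move=> x; apply: (@mulgI _ (f x)); rewrite -fM !mulgV morph_group1.
Qed.

Lemma morph_groupJ : {morph f : x y / x ^ y}.
Proof. by move=> x y; rewrite !conjgE !fM morph_groupV. Qed.

Lemma morph_groupR : {morph f : x y / [~ x, y]}.
Proof. by move=> x y; rewrite !commgEl fM morph_groupV morph_groupJ. Qed.

Lemma morph_groupX n : {morph f : x / x ^+ n}.
Proof.
by move=> x; elim: n => [|n IHn]; rewrite ?expg0 ?morph_group1 // !expgS fM IHn.
Qed.

Lemma morph_zexpg z : {morph f : x / zexpg x z}.
Proof.
by case: z => n x /=; rewrite ?morph_groupV morph_groupX.
Qed.

(** Left transparent, so that membership in the kernel reduces to [f x = 1]. *)
Definition kernel : normalSubgroup G.
Proof.
apply: (@NormalSubgroup G (fun x => f x = 1)).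
- exact: morph_group1.
- by move=> x y fx fy; rewrite fM fx fy mulg1.
- by move=> x fx; rewrite morph_groupV fx invg1.
- by move=> x y fx; rewrite morph_groupJ fx conj1g.
Defined.

End Morphisms.

Section QuotientLift.
Variables (G H : groupType) (f : G -> H) (N : normalSubgroup G).

Definition quotient_pi (x : G) : quotientGroup N := \pi x.

Lemma quotient_piM : {morph quotient_pi : x y / x * y}.
Proof. by move=> x y; exact/esym/quotient_mulE. Qed.

Lemma quotient_group_ind (P : quotientGroup N -> Prop) :
  (forall x, P (quotient_pi x)) -> forall q, P q.
Proof. by move=> PG; elim/quotW. Qed.

Lemma quotient_pi_eq x y : quotient_pi x = quotient_pi y <-> N (x^-1 * y).
Proof. by split=> [/coset_eqP/asboolP|Nxy]; last exact/coset_eqP/asboolP. Qed.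

Hypothesis fM : {morph f : x y / x * y}.
Hypothesis Nf : forall x, N x -> f x = 1.

Definition quotient_lift (q : quotientGroup N) : H := f (repr q).

Lemma quotient_liftE x : quotient_lift (quotient_pi x) = f x.
Proof.
have := Nf (coset_reprP N x); rewrite fM (morph_groupV fM) /quotient_lift => E.
by apply: (@mulgI _ (f x)^-1); rewrite mulVg.
Qed.

Lemma quotient_liftM : {morph quotient_lift : x y / x * y}.
Proof.
elim/quotient_group_ind=> x; elim/quotient_group_ind=> y.
by rewrite -quotient_piM !quotient_liftE fM.
Qed.

End QuotientLift.

Section KernelQuotient.
Variables (G H : groupType) (f : G -> H) (fM : {morph f : x y / x * y}).

Definition kernel_lift : quotientGroup (kernel fM) -> H :=
  @quotient_lift G H f (kernel fM).

Lemma kernel_liftE x : kernel_lift (quotient_pi _ x) = f x.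
Proof. exact: quotient_liftE. Qed.

Lemma kernel_liftM : {morph kernel_lift : x y / x * y}.
Proof. exact: quotient_liftM. Qed.

Lemma kernel_lift_inj : injective kernel_lift.
Proof.
elim/quotient_group_ind=> x; elim/quotient_group_ind=> y.
rewrite !kernel_liftE // => E; apply/quotient_pi_eq.
by rewrite /= fM (morph_groupV fM) E mulVg.
Qed.

Lemma kernel_quotient_finite : finite_set [set: H]%classic ->
  finite_set [set: quotientGroup (kernel fM)]%classic.
Proof.
move=> finH; rewrite -(preimage_setT kernel_lift).
by apply: finite_preimage finH => x y _ _; exact: kernel_lift_inj.
Qed.

End KernelQuotient.
Arguments kernel_lift {G H f} fM _.

Section FreeLift.
Variables (I : choiceType) (Q : groupType) (x : I -> Q).

Definition letter_eval (a : I * bool) : Q := if a.2 then x a.1 else (x a.1)^-1.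
Definition word_eval (u : seq (I * bool)) : Q := \prod_(a <- u) letter_eval a.

Lemma word_eval_free_eq u v : free_eq u v -> word_eval u = word_eval v.
Proof.
elim=> // {u v} [u v i b|u v w _ -> _ ->] //.
rewrite /word_eval !big_cat !big_cons /=.
by case: b; rewrite /letter_eval /= ?mulKg ?mulVKg.
Qed.

Definition free_lift (g : freeGroup I) : Q := word_eval (repr g).

Lemma free_liftE u : free_lift (\pi u) = word_eval u.
Proof. exact/esym/word_eval_free_eq/free_reprP. Qed.

Lemma free_liftM : {morph free_lift : g h / g * h}.
Proof.
elim/quotW=> u; elim/quotW=> v.
have -> : \pi_(freeGroup I) u * \pi_(freeGroup I) v
    = \pi_(freeGroup I) (u ++ v) by rewrite -free_mulE.
by rewrite !free_liftE /word_eval big_cat.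
Qed.

Lemma free_lift_gen i : free_lift (free_gen i) = x i.
Proof. by rewrite free_liftE /word_eval big_seq1. Qed.

End FreeLift.

Lemma free_group_ind (I : choiceType) (P : freeGroup I -> Prop) :
  P 1 -> (forall g h, P g -> P h -> P (g * h)) -> (forall g, P g -> P g^-1) ->
  (forall i, P (free_gen i)) -> forall g, P g.
Proof.
move=> P1 PM PV Pg; elim/quotW; elim=> [|[i b] u IHu]; first exact: P1.
have -> : \pi_(freeGroup I) ((i, b) :: u)
    = \pi_(freeGroup I) [:: (i, b)] * \pi_(freeGroup I) u.
  exact/esym/(free_mulE [:: (i, b)]).
apply: PM IHu; case: b; first exact: Pg.
by rewrite -[\pi _](free_invE [:: (i, true)]); exact: PV (Pg i).
Qed.

Section PresentedLift.
Variables (I : choiceType) (A : set (freeGroup I)) (Q : groupType) (x : I -> Q).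
Hypothesis xA : forall r, A r -> free_lift x r = 1.

Definition presented_gen (i : I) : presentedGroup A :=
  quotient_pi (normal_closure A) (free_gen i).

Definition presented_lift : presentedGroup A -> Q :=
  quotient_lift (free_lift x) (N := normal_closure A).

(** The kernel of [free_lift x] is one of the normal subgroups over which the normal closure is the
    intersection. *)
Lemma normal_closure_lift g : normal_closure A g -> free_lift x g = 1.
Proof. by move/(_ (kernel (free_liftM x))); apply; exact: xA. Qed.

Lemma presented_liftM : {morph presented_lift : g h / g * h}.
Proof. exact: quotient_liftM (free_liftM x) normal_closure_lift. Qed.

Lemma presented_lift_gen i : presented_lift (presented_gen i) = x i.
Proof.
rewrite /presented_lift quotient_liftE ?free_lift_gen //.
  exact: free_liftM.
exact: normal_closure_lift.
Qed.

End PresentedLift.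

Lemma presented_group_ind (I : choiceType) (A : set (freeGroup I))
    (P : presentedGroup A -> Prop) :
  P 1 -> (forall g h, P g -> P h -> P (g * h)) -> (forall g, P g -> P g^-1) ->
  (forall i, P (presented_gen A i)) -> forall g, P g.
Proof.
move=> P1 PM PV Pg; apply: quotient_group_ind.
have piM := @quotient_piM _ (normal_closure A).
apply: free_group_ind Pg => [|g h|g].
- by rewrite (morph_group1 piM).
- by rewrite piM; exact: PM.
- by rewrite (morph_groupV piM); exact: PV.
Qed.

(* Indices start at 0, as in [gen4]: [x i] stands for g_(i+1). *)
Definition satisfies (t : Z4) (Q : groupType) (x : 'I_4 -> Q) : Prop :=
  forall i j : 'I_4, (i < j)%N ->
    [~ x j, x i] =
    \prod_(k < 4 | (j < k)%N) zexpg (x k) (coef t i.+1 j.+1 k.+1).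

Definition Ggen (t : Z4) : 'I_4 -> Ggroup t := presented_gen (relators t).

Lemma morph_satisfies (t : Z4) (G H : groupType) (f : G -> H) x :
  {morph f : g h / g * h} -> satisfies t x -> satisfies t (f \o x).
Proof.
move=> fM xt i j ij /=; rewrite -(morph_groupR fM) (xt i j ij).
rewrite (big_morph f fM (morph_group1 fM)).
by apply: eq_bigr => k _; rewrite (morph_zexpg fM).
Qed.

Lemma Ggen_satisfies (t : Z4) : satisfies t (Ggen t).
Proof.
move=> i j ij; rewrite /Ggen /presented_gen.
set p := quotient_pi _.
have pM : {morph p : g h / g * h} by exact: quotient_piM.
rewrite -(morph_groupR pM).
under eq_bigr do rewrite -(morph_zexpg pM).
rewrite -(big_morph p pM (morph_group1 pM)).
apply/esym/quotient_pi_eq => N NA.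
set c := [~ _, _]; set d := bigop.body _ _ _.
have Ncd : N (c / d) by apply: NA; exists i, j.
(* The relator is [c / d], whereas cosets compare through [d^-1 * c]; the two are conjugate. *)
have -> : d^-1 * c = (c / d) ^ d by rewrite conjgE mulgVK.
exact: normalJ.
Qed.

(** Von Dyck's theorem for the presentation of G(t). *)
Lemma Ggroup_lift (t : Z4) (Q : groupType) (x : 'I_4 -> Q) : satisfies t x ->
  exists2 f : Ggroup t -> Q,
    {morph f : g h / g * h} & forall i, f (Ggen t i) = x i.
Proof.
move=> xt.
have xA r : relators t r -> free_lift x r = 1.
  case=> i [j [ij ->]]; pose fM := free_liftM x.
  rewrite fM (morph_groupV fM) (morph_groupR fM).
  rewrite (big_morph (free_lift x) fM (morph_group1 fM)).
  under eq_bigr do rewrite (morph_zexpg fM) free_lift_gen.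
  by rewrite !free_lift_gen (xt _ _ ij) mulgV.
exists (presented_lift x (A := relators t)); first exact: presented_liftM.
exact: presented_lift_gen.
Qed.

Lemma finite_quotient_class (G Q : groupType) (f : G -> Q) :
  {morph f : x y / x * y} -> (forall q, exists g, f g = q) ->
  finite_set [set: Q]%classic -> finite_quotient_classes G (iso_class Q).
Proof.
move=> fM f_surj finQ; exists (kernel fM); split.
  exact: kernel_quotient_finite.
apply/iso_class_eq/group_isog_sym.
pose hm := isMultiplicative.Build _ Q (kernel_lift fM) (@kernel_liftM _ _ _ fM).
pose h : {multiplicative quotientGroup (kernel fM) -> Q} :=
  HB.pack (kernel_lift fM) hm.
exists h.
have /choice [g hg] : forall q, exists k, h k = q.
  move=> q; have [x <-] := f_surj q.
  by exists (quotient_pi _ x); exact: kernel_liftE.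
by exists g => // k; apply: (@kernel_lift_inj _ _ _ fM); exact: hg.
Qed.

(** The range of [f] is a copy of G / ker f, a finite quotient of G and hence, up to an isomorphism
    [e], of H. The map [f'] is H -> H / N -> G / ker f -> Q, and has the same range as [f]. *)
Lemma finite_quotient_transfer (G H Q : groupType) (f : G -> Q) :
  finite_quotient_classes G = finite_quotient_classes H ->
  {morph f : x y / x * y} -> finite_set [set: Q]%classic ->
  exists2 f' : H -> Q, {morph f' : x y / x * y} &
    (forall h, exists g, f' h = f g) /\ (forall g, exists h, f g = f' h).
Proof.
move=> GH fM finQ.
have : finite_quotient_classes G (iso_class (quotientGroup (kernel fM))).
  by exists (kernel fM); split => //; exact: kernel_quotient_finite.
rewrite GH => -[N [_ /esym/iso_class_eq [e [e' eK e'K]]]].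
pose f' (h : H) := kernel_lift fM (e (quotient_pi N h)).
exists f'.
  by move=> x y; rewrite /f' quotient_piM gmulfM kernel_liftM.
split=> [h|g].
  rewrite /f'; elim/quotient_group_ind: (e _) => g.
  by exists g; rewrite kernel_liftE.
exists (repr (e' (quotient_pi _ g))).
by rewrite /f' /quotient_pi reprK e'K [RHS]kernel_liftE.
Qed.

(** * Consequences of the relations of G(t) *)

Definition quad (Q : Type) (x1 x2 x3 x4 : Q) (i : 'I_4) : Q :=
  nth x1 [:: x1; x2; x3; x4] i.

Lemma quadE (Q : Type) (x : 'I_4 -> Q) :
  x = quad (x (inord 0)) (x (inord 1%N)) (x (inord 2)) (x (inord 3)).
Proof.
apply/funext => -[[|[|[|[|//]]]] lt_i4]; congr x; apply/val_inj;
  by rewrite /= inordK.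
Qed.

(** The relations of G(t) for t = (a, b, c, 0) with natural exponents; a relation [y, x] = z is put
    as y^x = y z, or as [commute] when z = 1. *)
Definition relations_abc (a b c : nat) (Q : groupType) (x1 x2 x3 x4 : Q) :=
  [/\ x2 ^ x1 = x2 * (x3 ^+ a * x4 ^+ b), x3 ^ x1 = x3 * x4 ^+ c,
      commute x4 x1 & [/\ commute x3 x2, commute x4 x2 & commute x4 x3]].

Lemma satisfies_abc (a b c : nat) (Q : groupType) (x1 x2 x3 x4 : Q) :
  satisfies (MkZ4 a%:Z b%:Z c%:Z 0%Z) (quad x1 x2 x3 x4) <->
  relations_abc a b c x1 x2 x3 x4.
Proof.
have commg_conj (x y z : Q) : [~ x, y] = z <-> x ^ y = x * z.
  by rewrite commgEl; split=> [<-|->]; rewrite ?mulVKg ?mulKg.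
have commg_commute (x y : Q) : [~ x, y] = 1 <-> commute x y.
  by split=> [/eqP/commgP|/commgP/eqP].
split=> [H|[r12 r13 r14 [r23 r24 r34]]].
  pose o k := (inord k : 'I_4).
  have lt_o i j : (i < j)%N -> (j < 4)%N -> (o i < o j)%N.
    by move=> ij j4; rewrite !inordK // (ltn_trans ij).
  split.
  - move: (H (o 0) (o 1%N) (lt_o 0 1%N isT isT)).
    rewrite /quad !inordK //= big_mkcond !big_ord_recl big_ord0 /=.
    by rewrite ?inordK //= ?mul1g ?mulg1 => /commg_conj.
  - move: (H (o 0) (o 2) (lt_o 0 2 isT isT)).
    rewrite /quad !inordK //= big_mkcond !big_ord_recl big_ord0 /=.
    by rewrite ?inordK //= ?mul1g ?mulg1 => /commg_conj.
  - move: (H (o 0) (o 3) (lt_o 0 3 isT isT)).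
    rewrite /quad !inordK //= big_mkcond !big_ord_recl big_ord0 /=.
    by rewrite ?inordK //= ?mul1g ?mulg1 => /commg_commute.
  split.
  - move: (H (o 1%N) (o 2) (lt_o 1%N 2 isT isT)).
    rewrite /quad !inordK //= big_mkcond !big_ord_recl big_ord0 /=.
    by rewrite ?inordK //= ?mul1g ?mulg1 => /commg_commute.
  - move: (H (o 1%N) (o 3) (lt_o 1%N 3 isT isT)).
    rewrite /quad !inordK //= big_mkcond !big_ord_recl big_ord0 /=.
    by rewrite ?inordK //= ?mul1g ?mulg1 => /commg_commute.
  - move: (H (o 2) (o 3) (lt_o 2 3 isT isT)).
    rewrite /quad !inordK //= big_mkcond !big_ord_recl big_ord0 /=.
    by rewrite ?inordK //= ?mul1g ?mulg1 => /commg_commute.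
move=> [[|[|[|[|//]]]] i4] [[|[|[|[|//]]]] j4] //= _;
  rewrite /quad /= big_mkcond !big_ord_recl big_ord0 /= ?mul1g ?mulg1;
  by [apply/commg_conj | apply/commg_commute].
Qed.

Section Relations.
Variables (Q : groupType) (a b c : nat) (x1 x2 x3 x4 : Q).
Hypothesis rel : relations_abc a b c x1 x2 x3 x4.

Lemma rel_x4X k l : x4 ^+ k ^ x1 ^+ l = x4 ^+ k.
Proof.
case: rel => _ _ /(commuteX2 k l) x14 _.
by rewrite conjgE x14 mulKg.
Qed.

Lemma rel_x34 k l : commute (x3 ^+ k) (x4 ^+ l).
Proof.
by case: rel => _ _ _ [_ _ x34]; apply: commuteX2; exact/commute_sym.
Qed.

Lemma rel_merge i j k l :
  (x3 ^+ i * x4 ^+ j) * (x3 ^+ k * x4 ^+ l) = x3 ^+ (i + k) * x4 ^+ (j + l).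
Proof.
rewrite -mulgA (mulgA (x4 ^+ j)) -(rel_x34 k j) -mulgA -expgnDr mulgA.
by rewrite -expgnDr.
Qed.

Lemma rel_x3J k l : x3 ^+ k ^ x1 ^+ l = x3 ^+ k * x4 ^+ (c * l * k).
Proof.
case: (rel) => _ x31 _ _.
have x3J : x3 ^ x1 ^+ l = x3 * x4 ^+ (c * l).
  elim: l => [|l IHl]; first by rewrite conjg1 muln0 mulg1.
  rewrite expgS conjgM x31 conjMg IHl (rel_x4X c l) -mulgA -expgnDr.
  by rewrite mulnS addnC.
by rewrite conjXg x3J expgMn -?expgnA //; exact: (rel_x34 1%N).
Qed.

(** Passing from l to l + 1 conjugates a factor x3^a by x1^l, which adds a c l to the exponent of
    x4; these terms sum to 'C(l, 2) a c. *)
Lemma rel_x2J l :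
  x2 ^ x1 ^+ l = x2 * (x3 ^+ (a * l) * x4 ^+ (b * l + 'C(l, 2) * (a * c))).
Proof.
elim: l => [|l IHl]; first by rewrite conjg1 bin0n !muln0 !mulg1.
have [x21 _ _ _] := rel.
rewrite expgS conjgM x21 !conjMg IHl rel_x3J rel_x4X -!mulgA; congr (_ * _).
rewrite -expgnDr mulgA rel_merge; congr (_ ^+ _ * _ ^+ _).
  by rewrite mulnS addnC.
by rewrite binS bin1; lia.
Qed.

End Relations.

(** Only the relation for the new x2 and x1 involves b'. Both of its sides have the same exponent of
    x3, and their exponents of x4 are the two sides of the congruence, which suffices as x4^n =
    1. *)
Lemma retwist_relations (Q : groupType) (a b b' c n u e f : nat)
    (x1 x2 x3 x4 : Q) :
  relations_abc a b c x1 x2 x3 x4 -> x4 ^+ n = 1 ->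
  (b * u + 'C(u, 2) * (a * c) + c * u * f = e * a + u * u * b' %[mod n])%N ->
  relations_abc a b' c (x1 ^+ u) (x2 * x3 ^+ f)
    (x3 ^+ u * x4 ^+ e) (x4 ^+ (u * u)).
Proof.
move=> rel x4n eq_n; have [_ _ x14 [x23 x24 x34]] := rel.
have x4X k l : (k = l %[mod n])%N -> x4 ^+ k = x4 ^+ l.
  move=> kl; rewrite (divn_eq k n) (divn_eq l n) kl !expgnDr.
  by rewrite !(mulnC _ n) !expgnA x4n !expg1n.
have x43 k l := rel_x34 rel k l.
have x42 k : commute (x4 ^+ k) x2 by apply/commute_sym/commuteX/commute_sym.
have x32 k : commute (x3 ^+ k) x2 by apply/commute_sym/commuteX/commute_sym.
split; last split.
- rewrite conjMg (rel_x2J rel) (rel_x3J rel) -!mulgA; congr (_ * _).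
  rewrite [LHS]mulgA (rel_merge rel) expgMn // -!expgnA -[in RHS]mulgA.
  rewrite -expgnDr [RHS]mulgA -expgnDr.
  congr (_ ^+ _ * _); first lia.
  by apply: x4X; rewrite eq_n.
- rewrite conjMg (rel_x3J rel) (rel_x4X rel) -!mulgA -!expgnA -!expgnDr.
  by congr (_ * _ ^+ _); lia.
- exact: commuteX2.
- apply: commute_sym; apply: commuteM; apply: commute_sym; apply: commuteM.
  + exact: x32.
  + exact: commuteX2.
  + exact: x42.
  + exact/commute_sym/x43.
- by apply: commuteM; [exact: x42|exact/commute_sym/x43].
- apply: commuteM; first exact/commute_sym/x43.
  exact: commuteX2.
Qed.

(** Bezout gives v with n dividing 1 + v u, so that x^(u v) = x^-1. *)
Lemma coprime_expg_root (Q : groupType) (n u : nat) :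
  (0 < n)%N -> coprime u n ->
  exists v, forall x : Q, x ^+ n = 1 -> x ^+ u ^- v = x.
Proof.
move=> n_gt0 /eqP co_un; have [v _] := Bezoutr u n_gt0.
rewrite co_un => /dvdnP [q qn]; exists v => x xn; apply/esym/divg1_eq.
by rewrite invgK -expgnA mulnC -expgS -add1n qn mulnC expgnA xn expg1n.
Qed.

(** By the pigeonhole principle two powers of each x coincide, so x has a positive period; the
    product of the periods over the finite group is an exponent. *)
Lemma finite_group_exponent (Q : groupType) : finite_set [set: Q]%classic ->
  exists2 n, (0 < n)%N & forall x : Q, x ^+ n = 1.
Proof.
move=> /finite_seqP [s sQ].
have in_s (x : Q) : x \in s by have : [set: Q]%classic x by []; rewrite sQ.
have /choice [m xm] : forall x : Q, exists k, x ^+ k.+1 = 1.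
  move=> x; pose r := [seq x ^+ i | i <- iota 0 (size s).+1].
  have : ~~ uniq r.
    apply/negP => /uniq_leq_size /(_ (fun y _ => in_s y)).
    by rewrite size_map size_iota ltnn.
  case/(uniqPn 1%g) => i [j [ij]]; rewrite size_map size_iota => lt_j.
  rewrite !(nth_map 0%N) ?size_iota //; last exact: ltn_trans lt_j.
  rewrite !nth_iota //; last exact: ltn_trans lt_j.
  rewrite !add0n => E; exists (j - i).-1; rewrite prednK ?subn_gt0 //.
  by rewrite expgnFr ?(ltnW ij) // E mulgV.
exists (\prod_(y <- s) (m y).+1)%N; first by rewrite prodn_gt0.
move=> x; rewrite (big_rem x) //= expgnA xm; exact: expg1n.
Qed.

(** * Congruences *)

Section Congruences.
Local Open Scope nat_scope.

(** After division by the common gcd g, the quotients b1 and b2 are units modulo d1 = d / g, and u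
    has to be b1 / b2 modulo d1. Adding a multiple of d1 then makes u prime to n. *)
Lemma unit_congruence (b b' d n : nat) :
  0 < d -> 0 < n -> gcdn b d = gcdn b' d ->
  exists2 u, coprime u n & b' * u = b %[mod d].
Proof.
move=> d_gt0 n_gt0 gE; set g := gcdn b d in gE.
have g_gt0 : 0 < g by rewrite gcdn_gt0 d_gt0 orbT.
have [d1 dE] : exists d1, d = d1 * g by apply/dvdnP/dvdn_gcdr.
have [b1 bE] : exists b1, b = b1 * g by apply/dvdnP/dvdn_gcdl.
have [b2 b'E] : exists b2, b' = b2 * g by apply/dvdnP; rewrite gE dvdn_gcdl.
have co1 : coprime b1 d1.
  by rewrite /coprime -(eqn_pmul2r g_gt0) mul1n muln_gcdl -bE -dE.
have co2 : coprime b2 d1.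
  by rewrite /coprime -(eqn_pmul2r g_gt0) mul1n muln_gcdl -b'E -dE -gE.
have d1_gt0 : 0 < d1 by move: d_gt0; rewrite dE muln_gt0 => /andP [].
have [a _] := Bezoutr b2 d1_gt0; rewrite (eqP co2) => /dvdnP [q qE].
have co_a : coprime a d1.
  have : gcdn a d1 %| 1 + a * b2 by rewrite qE dvdn_mull // dvdn_gcdr.
  by rewrite dvdn_addl ?dvdn1 // dvdn_mulr // dvdn_gcdl.
(* As [a * b2] is -1 modulo d1, [a * a * b2] inverts [b2] modulo d1; adding
   [d1] makes [u0] positive, so that [\pi(u0)] is the set of its prime
   divisors. *)
pose u0 := b1 * (a * a * b2) + d1.
have u0_gt0 : 0 < u0 by rewrite addn_gt0 d1_gt0 orbT.
have co_u0 : coprime u0 d1.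
  rewrite /coprime gcdnC gcdnDr gcdnC -/(coprime _ _).
  by rewrite !coprimeMl co1 co_a co2.
(* A prime divisor of n divides k exactly when it does not divide u0. As u0 is prime to d1, it thus
   divides just one of u0 and d1 k, and not their sum. *)
pose k := n`_(\pi(u0)^').
exists (u0 + d1 * k).
  apply/contraT => nco; set r := gcdn (u0 + d1 * k) n.
  have /pdiv_prime p_pr : 1 < r.
    by rewrite ltn_neqAle eq_sym nco gcdn_gt0 n_gt0 orbT.
  set p := pdiv r in p_pr.
  have pu : p %| u0 + d1 * k by apply: dvdn_trans (pdiv_dvd _) (dvdn_gcdl _ _).
  have pn : p %| n by apply: dvdn_trans (pdiv_dvd _) (dvdn_gcdr _ _).
  have pk : (p %| k) = ~~ (p %| u0).
    have : (p \in primes k) = (p \notin primes u0) && (p \in primes n).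
      by rewrite primes_part mem_filter.
    by rewrite !mem_primes p_pr pn part_gt0 n_gt0 u0_gt0 /= andbT.
  case: (boolP (p %| u0)) => pu0.
    move: pu; rewrite dvdn_addr // Euclid_dvdM // pk pu0 orbF => pd1.
    move: (prime_gt1 p_pr); rewrite ltnNge -(eqP co_u0).
    by rewrite dvdn_leq ?gcdn_gt0 ?u0_gt0 // dvdn_gcd pu0.
  by move: pu; rewrite dvdn_addl ?(negPf pu0) // dvdn_mull // pk.
rewrite bE b'E dE -(mulnA b2) (mulnC g) mulnA -!muln_modl; congr (_ * g).
(* Multiples of d1 are added so that both sides become equal natural numbers by 1 + a b2 = q d1. *)
rewrite -(modnMDl (b1 * q)) -[RHS](modnMDl (b1 * a * b2 * q + b2 + b2 * k)).
congr (_ %% _); rewrite /u0; nia.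
Qed.

(** With gcd(a, c) = v a + w c and b = b' u + q (v a + w c), the integers e = u q v + 'C(u, 2) c and
    f = - q w turn the congruence into an equality: e absorbs the multiples of a, and f the
    remaining multiple of c. *)
Lemma bezout_congruence (a b b' c n u : nat) : 0 < n ->
  b' * u = b %[mod gcdn a c] ->
  exists e f,
    b * u + 'C(u, 2) * (a * c) + c * u * f = e * a + u * u * b' %[mod n].
Proof.
move=> n_gt0 bE.
have [q qE] : exists q : int, (b%:Z - (b' * u)%:Z = q * (gcdn a c)%:Z)%R.
  by apply/dvdzP; rewrite -eqz_mod_dvd !modz_nat; apply/eqP; rewrite bE.
have [v [w vw]] := Bezoutz a%:Z c%:Z.
(* Exponents must be natural numbers, so e and f are taken as residues modulo n. *)
have pos_mod (z : int) : exists m : nat, (m%:Z = z %[mod n%:Z])%Z.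
  exists `|(z %% n%:Z)%Z|%N; rewrite gez0_abs ?modz_ge0 ?modz_mod //; lia.
have [e eE] := pos_mod (u%:Z * (q * v) + 'C(u, 2)%:Z * c%:Z)%R.
have [f fE] := pos_mod (- (q * w))%R.
exists e, f; apply/eqP; rewrite -eqz_nat -!modz_nat eqz_mod_dvd.
move: eE fE => /eqP; rewrite eqz_mod_dvd => /dvdzP [q1 q1E] /eqP.
rewrite eqz_mod_dvd => /dvdzP [q2 q2E].
apply/dvdzP; exists (c%:Z * u%:Z * q2 - q1 * a%:Z)%R.
have eE : (e%:Z = q1 * n%:Z + (u%:Z * (q * v) + 'C(u, 2)%:Z * c%:Z))%R.
  by rewrite -q1E; ring.
have fE : (f%:Z = q2 * n%:Z - q * w)%R by rewrite -q2E; ring.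
have {}bE : (b%:Z = b'%:Z * u%:Z + q * (v * a%:Z + w * c%:Z))%R.
  by rewrite vw -[gcdz _ _]/(Posz (gcdn a c)) -qE PoszM; ring.
by rewrite !PoszD !PoszM eE fE bE; ring.
Qed.

(** Since w is prime to p, the same powers of p among those dividing d divide b and b'. Hence the
    p-parts of the two gcds agree for every p. *)
Lemma gcdn_prime_powers (b b' d : nat) : 0 < d ->
  (forall p k, maximal_prime_power p k d%:Z -> exists w : int,
    ~~ (p%:Z %| w)%Z /\ ((p ^ k)%N%:Z %| (b'%:Z * w - b%:Z)%R)%Z) ->
  gcdn b d = gcdn b' d.
Proof.
move=> d_gt0 H.
have eq_dvd p j : prime p -> 0 < j -> p ^ j %| d ->
    (p ^ j %| b) = (p ^ j %| b').
  move=> p_pr j_gt0 pjd.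
  have jk : j <= logn p d by rewrite -pfactor_dvdn.
  have [|w [pw pkw]] := H p (logn p d).
    split=> //; first exact: leq_trans jk.
      by rewrite dvdzE /= pfactor_dvdnn.
    by rewrite dvdzE /= pfactor_dvdn // ltnn.
  have {pkw} pjw : ((p ^ j)%N%:Z %| (b'%:Z * w - b%:Z)%R)%Z.
    by apply: dvdz_trans pkw; rewrite dvdzE /= dvdn_exp2l.
  have co_w : coprimez (p ^ j)%N%:Z w.
    by rewrite coprimezE coprimeXl // prime_coprime.
  rewrite -[p ^ j %| b]/(((p ^ j)%N%:Z %| b%:Z)%Z).
  rewrite -[p ^ j %| b']/(((p ^ j)%N%:Z %| b'%:Z)%Z) -(Gauss_dvdzl b'%:Z co_w).
  have /dvdzP [q qE] := pjw.
  apply/dvdzP/dvdzP => -[r rE]; [exists (q + r)%R | exists (r - q)%R].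
    by rewrite mulrDl -qE -rE; ring.
  by rewrite mulrBl -qE -rE; ring.
have dvd_gcd x y : (forall p j, prime p -> 0 < j -> p ^ j %| d ->
    p ^ j %| x -> p ^ j %| y) -> gcdn x d %| gcdn y d.
  move=> xy; apply/dvdn_partP => [|p]; first by rewrite gcdn_gt0 d_gt0 orbT.
  move=> p_g; have := p_g; rewrite mem_primes => /and3P [p_pr _ _].
  have := pfactor_dvdnn p (gcdn x d); rewrite p_part !dvdn_gcd => /andP [jx jd].
  by rewrite jd andbT; apply: (xy p) => //; rewrite logn_gt0.
by apply/eqP; rewrite eqn_dvd !dvd_gcd // => p j p_pr j_gt0 jd; rewrite eq_dvd.
Qed.

End Congruences.

(** * Comparison of groups with the same finite quotients *)

Section AdditiveMorphism.
Variables (Q : groupType) (B : zmodType) (chi : Q -> B).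
Hypothesis chiM : {morph chi : x y / x * y >-> (x + y)%R}.

Lemma additive_morph1 : chi 1 = 0%R.
Proof. by apply: (@addrI _ (chi 1)); rewrite -chiM mulg1 addr0. Qed.

Lemma additive_morphV x : chi x^-1 = (- chi x)%R.
Proof.
by apply: (@addrI _ (chi x)); rewrite -chiM mulgV additive_morph1 subrr.
Qed.

Lemma additive_morphX x n : chi (x ^+ n) = (chi x *+ n)%R.
Proof.
elim: n => [|n IHn]; first by rewrite expg0 additive_morph1.
by rewrite expgSr chiM IHn mulrSr.
Qed.

Lemma additive_morphJ x y : chi (x ^ y) = chi x.
Proof. by rewrite conjgE !chiM additive_morphV addrC addrK. Qed.

(** Conjugation becomes trivial in an abelian group, which leaves the linear relations with matrix
    [[a, b], [0, c]] on the images of x3 and x4. *)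
Lemma additive_morph_relations a b c x1 x2 x3 x4 :
  relations_abc a b c x1 x2 x3 x4 ->
  (chi x3 *+ a + chi x4 *+ b = 0)%R /\ (chi x4 *+ c = 0)%R.
Proof.
case=> /(congr1 chi) + /(congr1 chi) + _ _.
rewrite !additive_morphJ !chiM !additive_morphX -[LHS]addr0 => /addrI <-.
by rewrite -[LHS]addr0 => /addrI <-.
Qed.

End AdditiveMorphism.

Lemma morph_span (t : Z4) (Q : groupType) (psi : Ggroup t -> Q) (B : zmodType)
    (chi : Q -> B) :
  {morph psi : g h / g * h} -> {morph chi : x y / x * y >-> (x + y)%R} ->
  forall g, exists w : 'I_4 -> int,
    chi (psi g) = (\sum_j chi (psi (Ggen t j)) *~ w j)%R.
Proof.
move=> psiM chiM.
apply: presented_group_ind => [|g h [w wE] [v vE]|g [w wE]|i].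
- exists (fun=> 0%R).
  by rewrite (morph_group1 psiM) (additive_morph1 chiM) big1.
- exists (fun j => w j + v j)%R; rewrite psiM chiM wE vE -big_split.
  by apply: eq_bigr => j _; rewrite mulrzDr.
- exists (fun j => - w j)%R.
  rewrite (morph_groupV psiM) (additive_morphV chiM) wE -sumrN.
  by apply: eq_bigr => j _; rewrite mulrNz.
- exists (fun j => Posz (j == i)).
  rewrite (bigD1 i) //= eqxx mulr1z big1 ?addr0 //.
  by move=> j /negPf ->; rewrite mulr0z.
Qed.

(** The homomorphisms from G(s) and G(t) given by x and y have the same range in Q; after an
    additive map, a combination of the images of x is therefore one of the images of y. *)
Lemma same_quotients_span (s t : Z4) (Q : groupType) (x : 'I_4 -> Q) :
  finite_quotient_classes (Ggroup s) = finite_quotient_classes (Ggroup t) ->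
  finite_set [set: Q]%classic -> satisfies s x ->
  exists2 y : 'I_4 -> Q, satisfies t y &
    forall (B : zmodType) (chi : Q -> B),
      {morph chi : x y / x * y >-> (x + y)%R} ->
      forall z : 'I_4 -> nat, exists w : 'I_4 -> int,
        (\sum_i chi (x i) *+ z i = \sum_j chi (y j) *~ w j)%R.
Proof.
move=> st finQ /Ggroup_lift [f fM fx].
have [f' f'M [_ ff']] := finite_quotient_transfer st fM finQ.
exists (f' \o Ggen t); first exact/morph_satisfies/Ggen_satisfies.
move=> B chi chiM z.
have [h fh] := ff' (\prod_i Ggen s i ^+ z i).
have [w wE] := morph_span f'M chiM h.
exists w; rewrite -wE -fh.
rewrite (big_morph f fM (morph_group1 fM)).
rewrite (big_morph chi chiM (additive_morph1 chiM)).
by apply: eq_bigr => i _; rewrite (morph_groupX fM) fx (additive_morphX chiM).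
Qed.

(** Coefficients of y1 and y2 reduce modulo M and that of y3 modulo a, where each a y3 is traded for
    - b y4; then that of y4 reduces modulo c. So the span has at most M M a c elements. *)
Lemma span_card (B : zmodType) (y1 y2 y3 y4 : B) (M a b c : nat) (T : finType)
    (h : T -> B) :
  (0 < M)%N -> (0 < a)%N -> (0 < c)%N ->
  (y1 *+ M = 0)%R -> (y2 *+ M = 0)%R -> (y3 *+ a + y4 *+ b = 0)%R ->
  (y4 *+ c = 0)%R -> injective h ->
  (forall z, exists w1 w2 w3 w4 : int,
    h z = y1 *~ w1 + y2 *~ w2 + y3 *~ w3 + y4 *~ w4)%R ->
  (#|T| <= M * M * a * c)%N.
Proof.
move=> M0 a0 c0 y1M y2M y3a y4c h_inj hspan.
pose F (u : 'I_M * 'I_M * 'I_a * 'I_c) : B :=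
  (y1 *+ u.1.1.1 + y2 *+ u.1.1.2 + y3 *+ u.1.2 + y4 *+ u.2)%R.
have red (y : B) m (w : int) : (0 < m)%N -> (y *+ m = 0)%R ->
    exists i : 'I_m, (y *~ w = y *+ i)%R.
  move=> m0 ym.
  have m0' : (m%:Z != 0)%R by rewrite eqz_nat -lt0n.
  have lt_wm : (`|(w %% m%:Z)%Z| < m)%N.
    by rewrite -ltz_nat gez0_abs ?modz_ge0 // ltz_pmod.
  exists (Ordinal lt_wm); rewrite {1}(divz_eq w m) mulrzDr mulrC mulrzA.
  rewrite -pmulrn ym mul0rz add0r /= pmulrn gez0_abs ?modz_ge0 //.
have /choice [g gE] : forall z, exists u, h z = F u.
  move=> z; have [w1 [w2 [w3 [w4 ->]]]] := hspan z.
  have a0' : (a%:Z != 0)%R by rewrite eqz_nat -lt0n.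
  have [i iE] := red y1 M w1 M0 y1M.
  have [j jE] := red y2 M w2 M0 y2M.
  have lt_k : (`|(w3 %% a%:Z)%Z| < a)%N.
    by rewrite -ltz_nat gez0_abs ?modz_ge0 // ltz_pmod.
  have [l lE] := red y4 c (w4 - (w3 %/ a%:Z)%Z * b%:Z)%R c0 y4c.
  exists (i, j, Ordinal lt_k, l); rewrite /F /= -iE -jE -lE -!addrA.
  congr (_ + (_ + _))%R; rewrite [in LHS](divz_eq w3 a) (mulrzDr y3).
  rewrite (mulrC _ (Posz a)) mulrzA -pmulrn.
  have -> : (y3 *+ a = - (y4 *+ b))%R by apply/eqP; rewrite -addr_eq0 y3a.
  rewrite (pmulrn y3) gez0_abs ?modz_ge0 // mulrzBr mulNrz.
  rewrite (mulrC _ (Posz b)) mulrzA -pmulrn -addrA [LHS]addrC -addrA //.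
have g_inj : injective g by move=> z z' zz'; apply: h_inj; rewrite !gE zz'.
by have := leq_card g g_inj; rewrite !card_prod !card_ord.
Qed.

(* Heisenberg group times an additive group: (i, j, k, l) stands for
   x1^i x2^j x3^k x4^l, where x2 x1 = x1 x2 x3^alpha and x3, x4 are central. *)
Definition heisenberg (R : comNzRingType) (alpha : R) : Type :=
  (R * R * R * R)%type.

Section Heisenberg.
Variables (R : comNzRingType) (alpha : R).
Local Open Scope ring_scope.
Local Notation heis := (heisenberg alpha).

HB.instance Definition _ := Choice.on heis.

Definition heis_mul (x y : heis) : heis :=
  (x.1.1.1 + y.1.1.1, x.1.1.2 + y.1.1.2,
   x.1.2 + y.1.2 + alpha * x.1.1.2 * y.1.1.1, x.2 + y.2).
Definition heis_one : heis := (0, 0, 0, 0).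
Definition heis_inv (x : heis) : heis :=
  (- x.1.1.1, - x.1.1.2, - x.1.2 + alpha * x.1.1.2 * x.1.1.1, - x.2).

Let heis_mulA : associative heis_mul.
Proof.
move=> x y z; rewrite /heis_mul /=.
by congr (_, _, _, _); ring.
Qed.

Let heis_mul1 : left_id heis_one heis_mul.
Proof.
by move=> [[[i j] k] l]; rewrite /heis_mul /=; congr (_, _, _, _); ring.
Qed.

Let heis_mulr1 : right_id heis_one heis_mul.
Proof.
by move=> [[[i j] k] l]; rewrite /heis_mul /=; congr (_, _, _, _); ring.
Qed.

Let heis_mulV : left_inverse heis_one heis_inv heis_mul.
Proof.
by move=> [[[i j] k] l]; rewrite /heis_mul /=; congr (_, _, _, _); ring.
Qed.

Let heis_mulrV : right_inverse heis_one heis_inv heis_mul.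
Proof.
by move=> [[[i j] k] l]; rewrite /heis_mul /=; congr (_, _, _, _); ring.
Qed.

HB.instance Definition _ := isGroup.Build heis
  heis_mulA heis_mul1 heis_mulr1 heis_mulV heis_mulrV.

Lemma heis_mulE (i j k l i' j' k' l' : R) :
  (((i, j, k, l) : heis) * ((i', j', k', l') : heis))%g =
  (i + i', j + j', k + k' + alpha * j * i', l + l').
Proof. by []. Qed.

Lemma heis_expE (i j k l : R) n :
  (((i, j, k, l) : heis) ^+ n)%g =
  (i *+ n, j *+ n, k *+ n + alpha * i * j *+ 'C(n, 2), l *+ n).
Proof.
elim: n => [|n IHn]; first by rewrite !mulr0n addr0.
rewrite expgSr IHn heis_mulE binS bin1 !(mulrSr _ n) mulrnDr.
congr (_, _, _, _); rewrite -(mulr_natr j) -(mulr_natr _ n); ring.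
Qed.

Lemma heis_eq1 (i j k l : R) : (((i, j, k, l) : heis) = 1)%g ->
  [/\ i = 0, j = 0, k = 0 & l = 0].
Proof. by case. Qed.

(** Here z is the commutator [x, y]; its first two coordinates vanish, which makes it central. *)
Lemma heis_conj_fix (x y z : heis) : (x ^ y = x * z -> z ^ y = z)%g.
Proof.
rewrite !conjgE => /(canRL (mulVKg y)) E; apply/(canLR (mulKg y)); move: E.
case: x y z => [[[i j] k] l] [[[i' j'] k'] l'] [[[i'' j''] k''] l''].
rewrite !heis_mulE => -[].
have h (u v w : R) : u + v = v + (u + w) -> w = 0.
  by move=> E; apply: (@addrI _ (v + u)); rewrite addr0 -addrA -E addrC.
move=> /h -> /h -> _ _; congr (_, _, _, _); ring.
Qed.

End Heisenberg.

(** * Numerical invariants determined by the finite quotients *)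

Definition Gabc (a b c : nat) : groupType := Ggroup (MkZ4 a%:Z b%:Z c%:Z 0%Z).

Lemma same_quotients_relations (a b c a' b' c' : nat) (Q : groupType)
    (x1 x2 x3 x4 : Q) :
  finite_quotient_classes (Gabc a b c) =
    finite_quotient_classes (Gabc a' b' c') ->
  finite_set [set: Q]%classic -> relations_abc a b c x1 x2 x3 x4 ->
  exists y1 y2 y3 y4, relations_abc a' b' c' y1 y2 y3 y4 /\
    forall (B : zmodType) (chi : Q -> B),
      {morph chi : x y / x * y >-> (x + y)%R} ->
      forall z1 z2 z3 z4 : nat, exists w1 w2 w3 w4 : int,
        (chi x1 *+ z1 + chi x2 *+ z2 + chi x3 *+ z3 + chi x4 *+ z4 =
         chi y1 *~ w1 + chi y2 *~ w2 + chi y3 *~ w3 + chi y4 *~ w4)%R.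
Proof.
move=> st finQ /satisfies_abc xs.
have [y ys span] := same_quotients_span st finQ xs.
exists (y (inord 0)), (y (inord 1%N)), (y (inord 2)), (y (inord 3)).
split; first by apply/satisfies_abc; rewrite -quadE.
move=> B chi chiM z1 z2 z3 z4; have [w wE] := span _ _ chiM (quad z1 z2 z3 z4).
rewrite (quadE y) (quadE w) !big_ord_recl !big_ord0 in wE.
rewrite /quad /= !addr0 !addrA in wE.
by do 4 eexists; exact: wE.
Qed.

Lemma conjg_eqP (Q : groupType) (x y z : Q) : x * y = y * z -> x ^ y = z.
Proof. by rewrite conjgE => ->; rewrite mulKg. Qed.

Lemma finite_heis n (alpha : 'Z_n) : finite_set [set: heisenberg alpha]%classic.
Proof. exact: (@finite_finset ('Z_n * 'Z_n * 'Z_n * 'Z_n)%type). Qed.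

Lemma Zp_natr_inj n (i j : nat) : (1 < n)%N -> (i < n)%N -> (j < n)%N ->
  (i%:R = j%:R :> 'Z_n)%R -> i = j.
Proof.
move=> n_gt1 lt_in lt_jn /(congr1 val) /=.
by rewrite !val_Zp_nat // !modn_small.
Qed.

Section SameQuotients.
Local Open Scope ring_scope.
Variables (a b c a' b' c' : nat).
Hypotheses (a_gt0 : (0 < a)%N) (c_gt0 : (0 < c)%N).
Hypotheses (a'_gt0 : (0 < a')%N) (c'_gt0 : (0 < c')%N).
Hypothesis sameF :
  finite_quotient_classes (Gabc a b c) =
    finite_quotient_classes (Gabc a' b' c').

(** With M = a N, the combinations of the [chi] images of x1, x2, x3 take M M a distinct values,
    while those of y1, y2, y3 take at most M M a'. *)
Lemma same_quotients_c123 : (a <= a')%N.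
Proof.
clear c_gt0.
(* The factor a' c' kills y4; the factor 2 gives n > 1, so that ['Z_n] really is Z/n. *)
pose N := (2 * (a' * c'))%N; pose n := (a * (N * N))%N.
have N_gt1 : (1 < N)%N by rewrite /N; nia.
have n_gt1 : (1 < n)%N by rewrite /n; nia.
have n0 : (a%:R * (N%:R * N%:R) = 0 :> 'Z_n)%R.
  by rewrite -!natrM; apply: val_inj; rewrite /= val_Zp_nat // modnn.
pose H := heisenberg (a%:R : 'Z_n)%R.
pose x1 : H := (1, 0, 0, 0)%R; pose x2 : H := (0, 1, 0, 0)%R.
pose x3 : H := (0, 0, 1, 0)%R; pose x4 : H := (0, 0, 0, 0)%R.
have relx : relations_abc a b c x1 x2 x3 x4.
  split; last split; [apply: conjg_eqP | apply: conjg_eqP | ..];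
    rewrite /commute /x1 /x2 /x3 /x4 ?heis_expE ?heis_mulE ?mul0rn;
    congr (_, _, _, _);
    rewrite /= ?(mulr0, mul0r) ?mul0rn ?(addr0, add0r) ?mulr1 //; ring.
have [y1 [y2 [y3 [y4 [rely span]]]]] :=
  same_quotients_relations sameF (finite_heis _) relx.
have [y21 y31 y41 [y32 y42 y43]] := rely.
have y4X : (y4 ^+ N = 1)%g.
  have := heis_conj_fix y21.
  (* Conjugation by y1 fixes the central y3^a' y4^b', but multiplies it by y4^(a' c'), which is
     therefore 1. *)
  rewrite conjMg (rel_x3J rely a' 1) (rel_x4X rely b' 1).
  move=> /mulIg /(canRL (mulKg _)); rewrite mulVg muln1 => y4ca.
  by rewrite /N mulnC (mulnC a') expgnA y4ca expg1n.
(* As n = a N^2, multiplying k by N^2 makes chi additive; it kills y4, which is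
   N-torsion. *)
pose B : zmodType := ('Z_n * 'Z_n * 'Z_n)%type.
pose chi (q : H) : B :=
  (N%:R * q.1.1.1, N%:R * q.1.1.2, N%:R * N%:R * q.1.2)%R.
have chiM : {morph chi : x y / (x * y)%g >-> x + y}.
  move=> [[[i j] k] l] [[[i' j'] k'] l']; rewrite /chi heis_mulE.
  congr (_, _, _); rewrite /= ?mulrDr //.
  have -> : N%:R * N%:R * (a%:R * j * i') =
      a%:R * (N%:R * N%:R) * j * i' :> 'Z_n.
    by ring.
  by rewrite n0 !mul0r addr0.
have chi4 : chi y4 = 0%R.
  move: y4X; case: (y4) => [[[i j] k] l]; rewrite heis_expE => /heis_eq1 [].
  rewrite -[i *+ N]mulr_natl -[j *+ N]mulr_natl -[k *+ N]mulr_natl.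
  move=> iN jN kN _; rewrite /chi /= iN jN.
  have -> : N%:R * N%:R * k =
      N%:R * (N%:R * k + a%:R * i * j *+ 'C(N, 2))
      - a%:R * j * (N%:R * i) *+ 'C(N, 2) :> 'Z_n.
    by ring.
  by rewrite kN iN !(mulr0, mul0r) mul0rn subr0.
have mulnB (i j k : 'Z_n) m : ((i, j, k) : B) *+ m = (i *+ m, j *+ m, k *+ m).
  by elim: m => // m IHm; rewrite mulrS IHm !mulrS.
have chiN (q : H) : chi q *+ (a * N) = 0.
  have aN0 : (a * N)%:R * N%:R = 0 :> 'Z_n by rewrite natrM -mulrA.
  rewrite mulnB; congr (_, _, _);
    by rewrite -(mulr_natl _ (a * N)) !mulrA aN0 !mul0r.
have [chi3 _] := additive_morph_relations chiM rely.
pose h (u : 'I_(a * N) * 'I_(a * N) * 'I_a) : B :=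
  ((N * u.1.1)%:R, (N * u.1.2)%:R, (N * N * u.2)%:R).
have h_inj : injective h.
  have lt1 (i : 'I_(a * N)) : (N * i < n)%N.
    by rewrite /n; have := ltn_ord i; nia.
  have lt2 (k : 'I_a) : (N * N * k < n)%N by rewrite /n; have := ltn_ord k; nia.
  have N_gt0 : (0 < N)%N by exact: ltnW.
  have NN_gt0 : (0 < N * N)%N by rewrite muln_gt0 N_gt0.
  move=> [[i j] k] [[i' j'] k'] hE.
  have /(Zp_natr_inj n_gt1 (lt1 _) (lt1 _))/eqP :=
    congr1 (fun q : B => q.1.1) hE.
  have /(Zp_natr_inj n_gt1 (lt1 _) (lt1 _))/eqP :=
    congr1 (fun q : B => q.1.2) hE.
  have /(Zp_natr_inj n_gt1 (lt2 _) (lt2 _))/eqP :=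
    congr1 (fun q : B => q.2) hE.
  rewrite /= !(eqn_pmul2l N_gt0) (eqn_pmul2l NN_gt0).
  by move=> /eqP/ord_inj-> /eqP/ord_inj-> /eqP/ord_inj->.
have h_span u : exists w1 w2 w3 w4 : int,
    h u = chi y1 *~ w1 + chi y2 *~ w2 + chi y3 *~ w3 + chi y4 *~ w4.
  have [w1 [w2 [w3 [w4 w]]]] := span _ _ chiM u.1.1 u.1.2 u.2 0%N.
  exists w1, w2, w3, w4; rewrite -w mulr0n addr0 /chi /= !mulnB /h.
  congr (_, _, _); rewrite /= ?mulr1 ?mulr0 ?mul0rn ?addr0 ?add0r;
    by rewrite -?natrM -mulrnA.
have aN_gt0 : (0 < a * N)%N by rewrite muln_gt0 a_gt0 ltnW.
(* The bound is used with c = 1, as [chi y4] vanishes. *)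
have := span_card aN_gt0 a'_gt0 (ltn0Sn 0) (chiN y1) (chiN y2) chi3 chi4
  h_inj h_span.
by rewrite !card_prod !card_ord muln1 leq_pmul2l // muln_gt0 aN_gt0.
Qed.

(** For alpha = 0 the group is the abelian (Z/n)^4, in which x1, ..., x4 span n n a c elements and
    y1, ..., y4 at most n n a' c'. *)
Lemma same_quotients_c123_c134 : (a * c <= a' * c')%N.
Proof.
pose n := (2 * (a * c))%N.
have n_gt1 : (1 < n)%N by rewrite /n; nia.
have n0 : (2 * (a%:R * c%:R) = 0 :> 'Z_n)%R.
  by rewrite -!natrM; apply: val_inj; rewrite /= val_Zp_nat // modnn.
pose H := heisenberg (0 : 'Z_n)%R.
pose x1 : H := (1, 0, 0, 0)%R; pose x2 : H := (0, 1, 0, 0)%R.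
(* The rows of twice the adjugate of [[a, b], [0, c]]: they embed
   Z^2 / <(a, b), (0, c)>, of order a c, into (Z/n)^2. *)
pose x3 : H := (0, 0, 2 * c%:R, - (2 * b%:R)).
pose x4 : H := (0, 0, 0, 2 * a%:R).
have relx : relations_abc a b c x1 x2 x3 x4.
  split; last split; [apply: conjg_eqP | apply: conjg_eqP | ..];
    rewrite /commute /x1 /x2 /x3 /x4 ?heis_expE ?heis_mulE ?mul0rn;
    congr (_, _, _, _); rewrite /= ?(mulr0, mul0r) ?mul0rn ?(addr0, add0r) //.
  - by rewrite -(mulr_natr _ a) -mulrA (mulrC c%:R) n0.
  - by rewrite -(mulr_natr _ a) -(mulr_natr _ b); ring.
  - by rewrite -(mulr_natr _ c) -mulrA n0 addr0.
  - exact: addrC.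
have [y1 [y2 [y3 [y4 [rely span]]]]] :=
  same_quotients_relations sameF (finite_heis _) relx.
pose B : zmodType := ('Z_n * 'Z_n * 'Z_n * 'Z_n)%type.
pose chi (q : H) : B := (q.1.1.1, q.1.1.2, q.1.2, q.2).
have chiM : {morph chi : x y / (x * y)%g >-> x + y}.
  move=> [[[i j] k] l] [[[i' j'] k'] l']; rewrite /chi heis_mulE.
  by rewrite !mul0r addr0.
have mulnB (i j k l : 'Z_n) m :
    ((i, j, k, l) : B) *+ m = (i *+ m, j *+ m, k *+ m, l *+ m).
  by elim: m => // m IHm; rewrite mulrS IHm !mulrS.
have chin (q : H) : chi q *+ n = 0.
  have nr (i : 'Z_n) : i *+ n = 0 by rewrite -(mulr_natl i n) !natrM n0 mul0r.
  by rewrite mulnB !nr.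
have [chi3 chi4] := additive_morph_relations chiM rely.
pose h (u : 'I_n * 'I_n * 'I_a * 'I_c) : B :=
  (u.1.1.1%:R, u.1.1.2%:R, (2 * c * u.1.2)%:R,
   - (2 * b * u.1.2)%:R + (2 * a * u.2)%:R).
(* The last two coordinates are triangular: 2 c k < n determines k from the third, and then 2 a l <
   n determines l from the fourth. *)
have h_inj : injective h.
  have lt1 (i : 'I_a) : (2 * c * i < n)%N by rewrite /n; have := ltn_ord i; nia.
  have lt2 (k : 'I_c) : (2 * a * k < n)%N by rewrite /n; have := ltn_ord k; nia.
  move=> [[[i j] k] l] [[[i' j'] k'] l'] hE.
  have /(Zp_natr_inj n_gt1 (ltn_ord _) (ltn_ord _))/ord_inj :=
    congr1 (fun q : B => q.1.1.1) hE.
  have /(Zp_natr_inj n_gt1 (ltn_ord _) (ltn_ord _))/ord_inj :=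
    congr1 (fun q : B => q.1.1.2) hE.
  have /(Zp_natr_inj n_gt1 (lt1 _) (lt1 _))/eqP :=
    congr1 (fun q : B => q.1.2) hE.
  rewrite /= !eqn_pmul2l ?muln_gt0 ?c_gt0 // => /eqP/ord_inj kk -> ->.
  have := congr1 (fun q : B => q.2) hE; rewrite /= kk => /addrI.
  move=> /(Zp_natr_inj n_gt1 (lt2 _) (lt2 _))/eqP.
  by rewrite /= !eqn_pmul2l ?muln_gt0 ?a_gt0 // => /eqP/ord_inj->.
have h_span u : exists w1 w2 w3 w4 : int,
    h u = chi y1 *~ w1 + chi y2 *~ w2 + chi y3 *~ w3 + chi y4 *~ w4.
  have [w1 [w2 [w3 [w4 w]]]] := span _ _ chiM u.1.1.1 u.1.1.2 u.1.2 u.2.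
  exists w1, w2, w3, w4; rewrite -w /chi /= !mulnB /h.
  congr (_, _, _, _); rewrite /= ?mulr1 ?mulr0 ?mul0rn ?addr0 ?add0r //;
    by rewrite -?natrM ?mulNrn -!mulrnA.
have n_gt0 : (0 < n)%N by exact: ltnW.
have := span_card n_gt0 a'_gt0 c'_gt0 (chin y1) (chin y2) chi3 chi4
  h_inj h_span.
by rewrite !card_prod !card_ord -!mulnA !leq_pmul2l.
Qed.

(** Modulo g all the relations say that the generators commute, so x may be the standard basis of
    (Z/g)^4. Then y spans it too, hence is a basis, and the linear relations between y3 and y4 have
    coefficients divisible by g. *)
Lemma same_quotients_gcdn : (gcdn (gcdn a b) c %| gcdn (gcdn a' b') c')%N.
Proof.
set g := gcdn _ c.
have g_gt0 : (0 < g)%N by rewrite /g gcdn_gt0 c_gt0 orbT.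
(* The case g = 1 is set apart because ['Z_1] has two elements. *)
have [->|g_neq1] := eqVneq g 1%N; first exact: dvd1n.
have g_gt1 : (1 < g)%N by rewrite ltn_neqAle eq_sym g_neq1.
have dvd0 m : (g %| m)%N -> m%:R = 0 :> 'Z_g.
  by move=> /eqP gm; apply: val_inj; rewrite /= val_Zp_nat.
have ga : (g %| a)%N by rewrite /g !(dvdn_trans (dvdn_gcdl _ _)) // dvdn_gcdl.
have gb : (g %| b)%N by rewrite /g (dvdn_trans (dvdn_gcdl _ _)) // dvdn_gcdr.
have gc : (g %| c)%N by rewrite /g dvdn_gcdr.
pose H := heisenberg (0 : 'Z_g)%R.
pose x1 : H := (1, 0, 0, 0)%R; pose x2 : H := (0, 1, 0, 0)%R.
pose x3 : H := (0, 0, 1, 0)%R; pose x4 : H := (0, 0, 0, 1)%R.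
have relx : relations_abc a b c x1 x2 x3 x4.
  split; last split; [apply: conjg_eqP | apply: conjg_eqP | ..];
    rewrite /commute /x1 /x2 /x3 /x4 ?heis_expE ?heis_mulE ?mul0rn;
    congr (_, _, _, _);
    by rewrite /= ?dvd0 ?(mulr0, mul0r) ?mul0rn ?(addr0, add0r).
have [y1 [y2 [y3 [y4 [rely span]]]]] :=
  same_quotients_relations sameF (finite_heis _) relx.
pose chi (q : H) : 'rV['Z_g]_4 := \row_j quad q.1.1.1 q.1.1.2 q.1.2 q.2 j.
have chiM : {morph chi : x y / (x * y)%g >-> x + y}.
  move=> [[[i j] k] l] [[[i' j'] k'] l']; rewrite /chi heis_mulE.
  rewrite !mul0r addr0; apply/rowP => -[[|[|[|[|//]]]] m4]; by rewrite !mxE.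
have [chi3 chi4] := additive_morph_relations chiM rely.
pose Y : 'M['Z_g]_4 := \matrix_i chi (quad y1 y2 y3 y4 i).
have mulY (u : 'I_4 -> 'Z_g) :
    (\row_j u j) *m Y = \sum_j u j *: chi (quad y1 y2 y3 y4 j).
  by rewrite mulmx_sum_row; apply: eq_bigr => j _; rewrite rowK mxE.
have [Z ZY] : exists Z : 'M['Z_g]_4, Z *m Y = 1%:M.
  have /choice [z zE] : forall i : 'I_4, exists u : 'rV_4, u *m Y = row i 1%:M.
    move=> i; pose z (j : 'I_4) : nat := (j == i).
    have [w1 [w2 [w3 [w4 w]]]] :=
      span _ _ chiM (z (inord 0)) (z (inord 1)) (z (inord 2)) (z (inord 3)).
    exists (\row_j (quad w1 w2 w3 w4 j)%:~R).
    rewrite (mulY (fun j => (quad w1 w2 w3 w4 j)%:~R)).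
    rewrite !big_ord_recl big_ord0 /quad /= !scaler_int addr0 !addrA -w /z.
    case: i @z w => [[|[|[|[|//]]]] i4] z w;
      rewrite -!(inj_eq val_inj) /= !inordK //=
        !(mulr0n, mulr1n) ?(addr0, add0r);
      by apply/rowP => -[[|[|[|[|//]]]] m4]; rewrite !mxE.
  exists (\matrix_i z i); apply/row_matrixP => i; by rewrite row_mul rowK zE.
(* A left inverse of a square matrix over a commutative ring is also a right inverse, so spanning
   rows are independent. *)
have Y_inj u : u *m Y = 0 -> u = 0.
  by move=> uY; rewrite -[u]mulmx1 -(mulmx1C ZY) mulmxA uY mul0mx.
have eq0 m : m%:R = 0 :> 'Z_g -> (g %| m)%N.
  by move=> /(congr1 val) /=; rewrite val_Zp_nat // => /eqP.
have row0 (u : 'I_4 -> 'Z_g) : \sum_j u j *: chi (quad y1 y2 y3 y4 j) = 0 ->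
    forall j, u j = 0.
  by rewrite -mulY => /Y_inj /rowP u0 j; have := u0 j; rewrite !mxE.
have row34 (m k : nat) : chi y3 *+ m + chi y4 *+ k = 0 ->
    (g %| m)%N && (g %| k)%N.
  move=> E; have /row0 u0 : \sum_j quad 0 0 m%:R k%:R j *:
    chi (quad y1 y2 y3 y4 j) = 0.
    rewrite !big_ord_recl big_ord0 /quad /= !scale0r !scaler_nat.
    by rewrite !add0r addr0.
  apply/andP; split; apply: eq0.
    by have := u0 (inord 2); rewrite /quad inordK.
  by have := u0 (inord 3); rewrite /quad inordK.
have /andP [ga' gb'] := row34 _ _ chi3.
have /andP [_ gc'] : (g %| 0)%N && (g %| c')%N.
  by apply: row34; rewrite mulr0n add0r.
by rewrite !dvdn_gcd ga' gb'.
Qed.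

End SameQuotients.

(** * Transport of finite quotients, and the equivalence *)

(** The modified generators of a finite quotient of [Gabc a b c] satisfy the relations for b', which
    defines [psi] from [Gabc a b' c]. It is onto because the old generators are recovered from the
    new ones. *)
Lemma finite_quotients_retwist (a b b' c : nat) (C : groupType -> Prop) :
  (0 < a)%N -> (0 < c)%N -> gcdn b (gcdn a c) = gcdn b' (gcdn a c) ->
  finite_quotient_classes (Gabc a b c) C ->
  finite_quotient_classes (Gabc a b' c) C.
Proof.
move=> a_gt0 c_gt0 gE [N [finQ ->]].
have d_gt0 : (0 < gcdn a c)%N by rewrite gcdn_gt0 a_gt0.
have [n n_gt0 xn] := finite_group_exponent finQ.
have [u co_un uE] := unit_congruence d_gt0 n_gt0 gE.
have [e [f efE]] := bezout_congruence n_gt0 uE.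
have [v rootK] := coprime_expg_root (quotientGroup N) n_gt0 co_un.
pose t := MkZ4 (Posz a) (Posz b) (Posz c) 0%Z.
pose x k := quotient_pi N (Ggen t (inord k)).
have piM : {morph quotient_pi N : g h / g * h} by exact: quotient_piM.
have rel : relations_abc a b c (x 0%N) (x 1%N) (x 2%N) (x 3%N).
  apply/satisfies_abc; have := morph_satisfies piM (@Ggen_satisfies t).
  by rewrite [X in satisfies _ X]quadE.
have /satisfies_abc := retwist_relations rel (xn _) efE.
case/Ggroup_lift => psi psiM psi_gen.
pose im q := exists g, psi g = q.
have imM q r : im q -> im r -> im (q * r).
  by move=> [g <-] [h <-]; exists (g * h); exact: psiM.
have imV q : im q -> im q^-1.
  by move=> [g <-]; exists g^-1; exact: morph_groupV.
have imX q k : im q -> im (q ^+ k).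
  by move=> [g <-]; exists (g ^+ k); exact: morph_groupX.
have im_root q : im (q ^+ u) -> im q.
  by move=> imq; rewrite -(rootK q (xn q)); apply/imV/imX.
have im_gen i := ex_intro (fun g => psi g = _) _ (psi_gen i).
(* Generators are recovered from the last to the first: u-th roots stay in the image as u is prime
   to the exponent n, and the factors x4^e and x3^f are divided out once known to lie in it. *)
have im4 : im (x 3%N).
  apply/im_root/im_root; rewrite -expgnA.
  by have := im_gen (inord 3); rewrite /quad inordK.
have im3 : im (x 2%N).
  apply: im_root; rewrite -[_ ^+ u](mulgK (x 3%N ^+ e)).
  apply: imM; last exact/imV/imX.
  by have := im_gen (inord 2); rewrite /quad inordK.
have im2 : im (x 1%N).
  rewrite -[x 1%N](mulgK (x 2%N ^+ f)).
  apply: imM; last exact/imV/imX.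
  by have := im_gen (inord 1); rewrite /quad inordK.
have im1 : im (x 0%N).
  by apply: im_root; have := im_gen (inord 0); rewrite /quad inordK.
apply: (finite_quotient_class psiM) finQ; apply: quotient_group_ind.
apply: presented_group_ind => [|g h img imh|g img|i].
- by exists 1; rewrite (morph_group1 psiM) (morph_group1 piM).
- by rewrite piM; exact: imM.
- by rewrite (morph_groupV piM); exact: imV.
- by rewrite -[presented_gen _ i]/(Ggen t i) (quadE (Ggen t)) /quad;
     case: i => [[|[|[|[|//]]]] i4].
Qed.

Theorem theorem2 (s t : Z4) (hs : T211 s) (ht : T211 t) :
  finite_quotient_classes (Ggroup s) = finite_quotient_classes (Ggroup t) <->
  (c123 s = c123 t /\ c134 s = c134 t) /\
  (forall p k : nat, maximal_prime_power p k (dgcd s) ->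
     exists w : int,
       ~~ (p%:Z %| w)%Z /\ ((p ^ k)%N%:Z %| (c124 t * w - c124 s)%R)%Z).
Proof.
(* The sign conditions make all coefficients natural numbers. *)
have T211_nat r : T211 r -> exists a b c : nat,
    [/\ (0 < a)%N, (0 < c)%N & r = MkZ4 (Posz a) (Posz b) (Posz c) 0%Z].
  case: r => -[a|?] [b|?] [c|?] c234 [//= a_gt0 c_gt0 [//= _ _] ->].
  by exists a, b, c.
case: (T211_nat _ hs) (T211_nat _ ht) => {hs ht T211_nat}.
move=> a [b [c [a_gt0 c_gt0 ->]]] [a' [b' [c' [a'_gt0 c'_gt0 ->]]]] /=.
rewrite -!/(Gabc _ _ _) /dgcd /= -[gcdz _ _]/(Posz (gcdn a c)).
have d_gt0 : (0 < gcdn a c)%N by rewrite gcdn_gt0 a_gt0.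
split=> [sameF|[[[aE] [cE]] local]].
  have aE : a = a'.
    apply/eqP; rewrite eqn_leq.
    by rewrite (same_quotients_c123 a_gt0 a'_gt0 c'_gt0 sameF)
      (same_quotients_c123 a'_gt0 a_gt0 c_gt0 (esym sameF)).
  have cE : c = c'.
    apply/eqP; rewrite -(eqn_pmul2l a_gt0) {2}aE eqn_leq.
    by rewrite (same_quotients_c123_c134 a_gt0 c_gt0 a'_gt0 c'_gt0 sameF)
      (same_quotients_c123_c134 a'_gt0 c'_gt0 a_gt0 c_gt0 (esym sameF)).
  have gE : gcdn b (gcdn a c) = gcdn b' (gcdn a c).
    rewrite !gcdnA !(gcdnC _ a) {2}aE {2}cE.
    apply/eqP; rewrite eqn_dvd.
    rewrite (same_quotients_gcdn c_gt0 sameF).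
    exact: same_quotients_gcdn c'_gt0 (esym sameF).
  split; first by rewrite aE cE.
  move=> p k [p_pr k_gt0 pk_d _].
  (* A single u prime to d with b' u = b modulo d serves as w_p for every p. *)
  have [u co_ud uE] := unit_congruence d_gt0 d_gt0 gE.
  exists (Posz u); split.
    rewrite dvdzE /= -prime_coprime // coprime_sym.
    apply: coprime_dvdr co_ud; apply: dvdn_trans pk_d; exact: dvdn_exp.
  apply: (dvdz_trans pk_d).
  by rewrite -eqz_mod_dvd !modz_nat uE.
have gE := gcdn_prime_powers d_gt0 local.
rewrite -aE -cE; apply/funext => C; apply/propext; split.
  exact: finite_quotients_retwist.
by apply: finite_quotients_retwist.
Qed.
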